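(* Let $\mathcal{G}=(\mathcal{V},\mathcal{E},\mathcal{W},\mathcal{S})$ be a connected, undirected, edge-weighted, time-scaled graph with vertex set $\mathcal{V}=\{1,\dots,n\}$, edge weights $w_{ij}>0$ for $ij\in\mathcal{E}$ and vertex time scales $\epsilon_i>0$. For every spanning tree $\mathcal{T}'\subseteq\mathcal{G}$, the edge consensus system $\hat\Sigma^{\mathcal{T}'}:=\hat\Sigma^{\mathcal{T}'}[\mathcal{T}']$ on $\mathcal{T}'$ (which inherits the edge weights and time scales of $\mathcal{G}$) has squared $\mathcal{H}_2$ norm $$\mathcal{H}_2^2(\hat\Sigma^{\mathcal{T}'})=\frac{\sigma_\omega^2}{2}\sum_{e\in\mathcal{T}'}w_e^{-1}+\frac{\sigma_v^2}{2}\sum_{i=1}^n\frac{\deg(i)}{\epsilon_i},$$ where $\deg(i)$ is the unweighted degree of $i$ in $\mathcal{T}'$. Moreover, the greedy algorithm described in the context returns a spanning tree $\mathcal{T}^*\subseteq\mathcal{G}$ that minimizes this quantity over all spanning trees of $\mathcal{G}$.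
   Context: Edge consensus. For an undirected graph $\mathcal{H}$ on $\mathcal V=\{1,\dots,n\}$, $D_{\mathcal H}$ denotes the incidence matrix: the column of edge $ij$ has $1$ in one of the positions $i,j$ and $-1$ in the other (orientation arbitrary) and zeros elsewhere. $W_{\mathcal H}$ is the diagonal matrix of edge weights, and $E=\mathrm{diag}(\epsilon_1,\dots,\epsilon_n)$. For a connected graph $\mathcal H$ and a spanning tree $\mathcal T\subseteq\mathcal H$, $D_{\mathcal H\setminus\mathcal T}$ is the incidence matrix of the edges of $\mathcal H$ not in $\mathcal T$, $T_{\mathcal T}=(D_{\mathcal T}^\top D_{\mathcal T})^{-1}D_{\mathcal T}^\top D_{\mathcal H\setminus\mathcal T}$, $R_{\mathcal H}=[\,I\;\;T_{\mathcal T}\,]$ (with $R_{\mathcal H}=I$ if $\mathcal H=\mathcal T$), columns of $D_{\mathcal H}$ and $W_{\mathcal H}$ being ordered with tree edges first, and $\mathcal L^{\mathcal T}=D_{\mathcal T}^\top E^{-1}D_{\mathcal T}$ is the edge Laplacian. The system $\hat\Sigma^{\mathcal T}[\mathcal H]$ is $$\dot x_{\mathcal T}=-\mathcal L^{\mathcal T}R_{\mathcal H}W_{\mathcal H}R_{\mathcal H}^\top x_{\mathcal T}+D_{\mathcal T}^\top E^{-1}\omega-\mathcal L^{\mathcal T}R_{\mathcal H}v,\qquad z=x_{\mathcal T},$$ with independent zero-mean Gaussian white noises $\omega,v$ of covariances $\Omega^2$ and $\Gamma^2$, where $\Omega=\sigma_\omega E^{1/2}$, $\Gamma=\sigma_vW_{\mathcal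 H}^{1/2}$, and $\sigma_\omega,\sigma_v>0$. Its squared $\mathcal H_2$ norm (steady-state output covariance trace) is $\mathbf{tr}[X^*]$, with $X^*$ the solution of the associated Lyapunov equation, and is given by $$\mathcal H_2^2(\hat\Sigma^{\mathcal T}[\mathcal H])=\frac{\sigma_\omega^2}{2}\mathbf{tr}\left[(R_{\mathcal H}W_{\mathcal H}R_{\mathcal H}^\top)^{-1}\right]+\frac{\sigma_v^2}{2}\mathbf{tr}\left[\mathcal L^{\mathcal T}\right].$$ Greedy algorithm (Minimum-$\mathcal{H}_2$ Spanning Tree). Input: $\mathcal G=(\mathcal V,\mathcal E,\mathcal W,\mathcal S)$. Choose any $v\in\mathcal V$ and set $\mathcal Q=\mathcal V\setminus\{v\}$, $\mathcal P=\{v\}$, $\mathcal R=\emptyset$. While $|\mathcal Q|>0$: let $N(\mathcal P)=\{j\in\mathcal Q: ij\in\mathcal E\text{ for some }i\in\mathcal P\}$; choose a pair $(j^*,j^*k)$ minimizing $\sigma_v^2(\epsilon_k^{-1}+\epsilon_j^{-1})+\sigma_\omega^2w_{jk}^{-1}$ over all $j\in N(\mathcal P)$ and $k\in\mathcal P$ with $jk\in\mathcal E$ (ties broken arbitrarily); replace $\mathcal P$ by $\mathcal P\cup\{j^*\}$, $\mathcal R$ by $\mathcal R\cup\{j^*k\}$, and $\mathcal Q$ by $\mathcal Q\setminus\{j^*\}$. Output: $\mathcal T^*=(\mathcal P,\mathcal R,\mathcal W(\mathcal R),\mathcal S)$, where $\mathcal W(\mathcal R)$ are the weights of the edges in $\mathcal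 R$. *)

(* Defs.v *)
From mathcomp Require Import all_boot all_order all_algebra.
From mathcomp Require Import boolp classical_sets reals constructive_ereal.
From mathcomp Require Import complex.

Set Implicit Arguments.
Unset Strict Implicit.
Unset Printing Implicit Defensive.

Import Order.TTheory GRing.Theory Num.Theory.
Local Open Scope ring_scope.

(* A graph on the vertex set 'I_n is given by its set of edges, an edge ij
   being the two-element set [set i; j].  Hence F \subset G says that F is a
   subgraph of G containing all the vertices. *)
Notation edge n := {set 'I_n}.

Definition simple_edges n (G : {set edge n}) : Prop :=
  forall e, e \in G -> #|e| = 2.

Definition adj n (G : {set edge n}) : rel 'I_n :=
  fun i j => [set i; j] \in G.

Definition connected_graph n (G : {set edge n}) : Prop :=
  forall i j, connect (adj G) i j.

(* The length bound excludes the sequences [:: i] and [:: i; j], which trace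
   no edge or the same edge back and forth. *)
Definition acyclic n (G : {set edge n}) : Prop :=
  forall c : seq 'I_n, (2 < size c)%N -> ~ ucycle (adj G) c.

Definition spanning_tree n (G T : {set edge n}) : Prop :=
  [/\ T \subset G, connected_graph T & acyclic T].

Definition deg n (G : {set edge n}) (i : 'I_n) : nat :=
  #|[set e in G | i \in e]|.

Definition hurwitz (R : realType) m (A : 'M[R]_m) : Prop :=
  forall z : R[i],
    eigenvalue (map_mx (real_complex R) A) z -> complex.Re z < 0.

(* For A Hurwitz the Lyapunov equation has exactly one solution. *)
Definition lyapunov_sol (R : realType) m (A N : 'M[R]_m) : 'M[R]_m :=
  xget 0 [set X | A *m X + X *m A^T + N = 0]%classic.

(* Squared H2 norm of dx/dt = A x + (white noise of intensity N), z = C x: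
   the steady-state covariance trace of z, which is +oo by convention when A is
   not Hurwitz. *)
Definition H2_squared (R : realType) m q (A N : 'M[R]_m) (C : 'M[R]_(q, m)) :
    \bar R :=
  if `[< hurwitz A >] then (\tr (C *m lyapunov_sol A N *m C^T))%:E else +oo%E.

(* o e is the endpoint of e that carries the entry 1 in the column of e. *)
Definition orientation n (G : {set edge n}) (o : edge n -> 'I_n) : Prop :=
  forall e, e \in G -> o e \in e.

Definition incidence (R : realType) n (o : edge n -> 'I_n)
    (F : {set edge n}) : 'M[R]_(n, #|F|) :=
  \matrix_(i, k) let e := enum_val k in
                 if i == o e then 1 else if i \in e then -1 else 0.

Definition vdiag (R : realType) n (f : 'I_n -> R) : 'M[R]_n :=
  diag_mx (\row_i f i).

(* Diagonal matrix of f over the edges of H, those of T coming first. *)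
Definition ediag (R : realType) n (T H : {set edge n}) (f : edge n -> R) :
    'M[R]_(#|T| + #|H :\: T|) :=
  diag_mx (row_mx (\row_k f (enum_val k)) (\row_k f (enum_val k))).

Definition edge_laplacian (R : realType) n (eps : 'I_n -> R)
    (o : edge n -> 'I_n) (T : {set edge n}) : 'M[R]_#|T| :=
  (incidence R o T)^T *m invmx (vdiag eps) *m incidence R o T.

Definition Tmx (R : realType) n (o : edge n -> 'I_n) (T H : {set edge n}) :
    'M[R]_(#|T|, #|H :\: T|) :=
  invmx ((incidence R o T)^T *m incidence R o T)
    *m (incidence R o T)^T *m incidence R o (H :\: T).

(* When H = T the right block has no column, so that this is the identity. *)
Definition Rmx (R : realType) n (o : edge n -> 'I_n) (T H : {set edge n}) :
    'M[R]_(#|T|, #|T| + #|H :\: T|) :=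
  row_mx 1%:M (Tmx R o T H).

(* H2_edge_consensus w eps sw sv o T H is the squared H2 norm of the edge
   consensus system of H on the spanning tree T:
     dx/dt = A x + Bomega omega + Bv v,   z = x,
   where omega and v are independent white noises of covariances Omega^2 and
   Gamma^2, Omega and Gamma being diagonal. *)
Definition H2_edge_consensus (R : realType) n (w : edge n -> R)
    (eps : 'I_n -> R) (sw sv : R) (o : edge n -> 'I_n)
    (T H : {set edge n}) : \bar R :=
  let L := edge_laplacian eps o T in
  let RH := Rmx R o T H in
  let A := - (L *m RH *m ediag T H w *m RH^T) in
  let Bomega := (incidence R o T)^T *m invmx (vdiag eps) in
  let Bv := - (L *m RH) in
  let Omega := sw *: vdiag (fun i => Num.sqrt (eps i)) in
  let Gamma := sv *: ediag T H (fun e => Num.sqrt (w e)) in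
  H2_squared A (Bomega *m (Omega *m Omega) *m Bomega^T
                + Bv *m (Gamma *m Gamma) *m Bv^T) 1%:M.

(* The sets P, Q, R of the greedy algorithm. *)
Record greedy_state n := GreedyState {
  reached : {set 'I_n};
  remaining : {set 'I_n};
  chosen : {set edge n} }.

Definition greedy_init n (v : 'I_n) : greedy_state n :=
  GreedyState [set v] ([set: 'I_n] :\ v) finset.set0.

Definition frontier n (G : {set edge n}) (s : greedy_state n) : {set 'I_n} :=
  [set j in remaining s | [exists i in reached s, [set i; j] \in G]].

Definition candidate n (G : {set edge n}) (s : greedy_state n)
    (j k : 'I_n) : bool :=
  [&& j \in frontier G s, k \in reached s & [set j; k] \in G].

Definition greedy_cost (R : realType) n (w : edge n -> R) (eps : 'I_n -> R)
    (sw sv : R) (j k : 'I_n) : R :=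
  sv ^+ 2 * ((eps k)^-1 + (eps j)^-1) + sw ^+ 2 * (w [set j; k])^-1.

Definition greedy_step (R : realType) n (G : {set edge n}) (w : edge n -> R)
    (eps : 'I_n -> R) (sw sv : R) (s s' : greedy_state n) : Prop :=
  exists j k : 'I_n,
    [/\ candidate G s j k,
        forall j' k', candidate G s j' k' ->
          greedy_cost w eps sw sv j k <= greedy_cost w eps sw sv j' k'
      & s' = GreedyState (j |: reached s) (remaining s :\ j)
                         ([set j; k] |: chosen s)].

(* Total correctness of the while loop started in the state s: whatever the
   choices made, no iteration lacks a candidate, the loop terminates, and the
   final state satisfies post. *)
Inductive greedy_ensures (R : realType) n (G : {set edge n})
    (w : edge n -> R) (eps : 'I_n -> R) (sw sv : R)
    (post : greedy_state n -> Prop) (s : greedy_state n) : Prop :=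
| greedy_stop : #|remaining s| = 0%N -> post s ->
    greedy_ensures G w eps sw sv post s
| greedy_iter : (0 < #|remaining s|)%N ->
    (exists s', greedy_step G w eps sw sv s s') ->
    (forall s', greedy_step G w eps sw sv s s' ->
       greedy_ensures G w eps sw sv post s') ->
    greedy_ensures G w eps sw sv post s.

(* Main.v *)
Require Import Defs.
From mathcomp Require Import all_boot all_order all_algebra.
From mathcomp Require Import boolp classical_sets reals constructive_ereal.
From mathcomp Require Import fintype finset complex ring.

Set Implicit Arguments.
Unset Strict Implicit.
Unset Printing Implicit Defensive.

Import Order.TTheory GRing.Theory Num.Theory.
Local Open Scope ring_scope.

(** The squared norm of a tree is half the sum over its edges [e] of
    [sv^2 * \sum_(i in e) (eps i)^-1 + sw^2 / w e], because each edge adds one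
    to the degree of each of its endpoints ([sum_degree]).  This weight of
    [[set j; k]] is what the greedy algorithm minimizes, so the algorithm is
    Prim's algorithm for this weight.

    Formula for the norm.  On a tree [T] the matrix [R_T] is the identity, so
    with [L = D^T E^-1 D] the system matrix is [- L W] and the noise intensity
    is [sw^2 L + sv^2 L W L].  The Lyapunov equation is then solved by
    [(sw^2 W^-1 + sv^2 L) / 2], whose trace is the claimed value.  Since this
    norm is the trace of the chosen solution of the equation, and only if
    [- L W] is Hurwitz, two more facts are needed, and both come from the
    injectivity of [D].  Every edge [e] of a forest is a bridge, and the cut
    around one side of [e] crosses no other edge; hence the indicators of these
    sides are, up to sign, the rows of a left inverse of [D]
    ([incidence_left_inverse]).  If [v] is a left eigenvector of [- L W] for
    [z], pairing [- v L = z v W^-1] with the conjugate of [v] gives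
    [- (v L v^* ) = z (v W^-1 v^* )] with both forms positive, so [z] is real
    and negative ([eigenvalue_gradient_lt0]).  If [L W X + X W L = 0], taking
    the trace against [W X^T W] yields two nonnegative sums of squares that add
    up to [0], so [D W X = 0] and [X = 0] ([lyapunov_gradient_eq0]).

    Greedy algorithm.  The invariant is that the chosen edges form a tree on
    the reached vertices ([partial_tree]), and that below every spanning tree
    there is one, no more expensive, that contains all the chosen edges.  An
    iteration preserves it by the exchange property
    ([spanning_tree_exchange]): if the spanning tree lacks the new edge [jk],
    its path from [j] to [k] leaves the unreached vertices through an edge that
    was a candidate too, hence costs at least as much, and replacing this edge
    by [jk] yields a spanning tree.  At the end the chosen edges span, and a
    spanning tree containing them has as many edges, so it is equal to them.

    Trees are recognized by counting: a connected graph contains a connected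
    subgraph with [n - 1] edges, so an acyclic connected graph has exactly
    [n - 1] edges, while a connected graph with fewer than [n] edges loses its
    connectedness with any edge, and so has no cycle. *)

(** * Connectivity, bridges and cuts *)

Lemma adj_sym n (G : {set edge n}) : symmetric (adj G).
Proof. by move=> i j; rewrite /adj setUC. Qed.

Lemma connect_adj_sym n (G : {set edge n}) : connect_sym (adj G).
Proof. exact/sym_connect_sym/adj_sym. Qed.

Lemma connect_adjS n (F G : {set edge n}) : F \subset G ->
  subrel (connect (adj F)) (connect (adj G)).
Proof.
by move=> sFG; apply: connect_sub => i j Fij; apply/connect1/(subsetP sFG).
Qed.

(** Any walk in [T] can be rerouted around the edge [xy]. *)
Lemma connected_replace_edge n (F T : {set edge n}) (x y : 'I_n) :
    connected_graph T -> T :\ [set x; y] \subset F -> connect (adj F) x y ->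
  connected_graph F.
Proof.
move=> Tconn sTF Fxy i j; apply: connect_sub (Tconn i j) => a b Tab.
have [eq_e|neq_e] := eqVneq [set a; b] [set x; y]; last first.
  by apply/connect1/(subsetP sTF); rewrite in_setD1 neq_e.
have: a \in [set x; y] by rewrite -eq_e set21.
have: b \in [set x; y] by rewrite -eq_e set22.
by rewrite !in_set2 => /orP[]/eqP-> /orP[]/eqP->; rewrite // connect_adj_sym.
Qed.

Lemma path_avoid n (T : {set edge n}) (i a b : 'I_n) (p : seq 'I_n) :
  i \notin a :: p -> path (adj T) a p -> path (adj (T :\ [set i; b])) a p.
Proof.
elim: p a => //= c p IHp a; rewrite !inE !negb_or => /and3P[ia ic ip].
case/andP=> Tac Tcp; rewrite IHp ?inE ?negb_or ?ic //= andbT.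
rewrite /adj in_setD1; apply/andP; split=> //; apply: contraNneq ia => e_ac.
have: i \in [set a; c] by rewrite e_ac set21.
by rewrite in_set2 (negPf ic) orbF.
Qed.

(** A simple path that joins the ends of an edge without using it closes with
    this edge into a cycle. *)
Lemma acyclic_bridge n (T : {set edge n}) (a b : 'I_n) :
    acyclic T -> a != b -> [set a; b] \in T ->
  ~~ connect (adj (T :\ [set a; b])) a b.
Proof.
move=> Tacyc neq_ab Tab; apply/negP=> /connectP[p0 p0_path lastp0].
case/shortenP: p0_path lastp0 => p p_path p_uniq _ eq_b {p0}.
apply: (Tacyc (a :: p)).
  (* A path with a single edge from a to b would be the removed edge. *)
  case: p p_path p_uniq eq_b => [_ _ /= eq_b|c [|//]].
    by rewrite eq_b eqxx in neq_ab.
  by rewrite /= andbT => + _ eq_b; rewrite -eq_b /adj !inE eqxx.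
apply/andP; split=> //=; rewrite rcons_path -eq_b adj_sym.
apply/andP; split=> //.
apply: sub_path p_path => i j; apply: subsetP; apply: subD1set.
Qed.

(** A simple path from [j] to [k] meets the cut around [S].  Taking the first
    edge [xy] across it, the part before [x] stays outside of [S] and the part
    after [y] never returns to [x], so neither uses [xy] again: this is what
    allows [xy] to be traded for [jk] without disconnecting the graph. *)
Lemma crossing_edge n (T : {set edge n}) (S : {set 'I_n}) (j k : 'I_n) :
    connect (adj T) j k -> j \notin S -> k \in S ->
  exists x y, [/\ x \notin S, y \in S, [set x; y] \in T,
    connect (adj (T :\ [set x; y])) j x & connect (adj (T :\ [set x; y])) y k].
Proof.
case/connectP=> p0 p0_path lastp0.
case/shortenP: p0_path lastp0 => p p_path p_uniq _ -> {p0 k}.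
elim: p j p_path p_uniq => [j _ _ /negPf/= ->//|a p IHp j].
move=> /= /andP[Tja Tap] /andP[j_ap ap_uniq] jS lastS.
have [aS|aS] := boolP (a \in S).
  exists j, a; split=> //; apply/connectP; exists p => //.
  exact: path_avoid.
have [x [y [xS yS Txy ax y_last]]] := IHp a Tap ap_uniq aS lastS.
exists x, y; split=> //; apply: connect_trans ax; apply: connect1.
rewrite /adj in_setD1; apply/andP; split=> //; apply: contraTneq yS => e_ja.
have: y \in [set j; a] by rewrite e_ja set22.
by rewrite in_set2 => /orP[]/eqP->.
Qed.

(** * Growing a tree, and counting its edges *)

(** The state of the greedy algorithm between two iterations.  Being a tree is
    expressed by connectedness and the number of edges: acyclicity then only
    has to be established once, for the final graph. *)
Definition partial_tree n (G : {set edge n}) (S : {set 'I_n})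
    (F : {set edge n}) : Prop :=
  [/\ F \subset G, forall e, e \in F -> e \subset S,
      {in S &, forall i j, connect (adj F) i j} & #|F|.+1 = #|S|].

Lemma partial_tree1 n (G : {set edge n}) (v : 'I_n) :
  partial_tree G [set v] finset.set0.
Proof.
split; [exact: sub0set|by move=> e; rewrite inE| |by rewrite cards0 cards1].
by move=> i j /set1P-> /set1P->.
Qed.

Lemma partial_tree_add n (G : {set edge n}) S F (j k : 'I_n) :
    partial_tree G S F -> j \notin S -> k \in S -> [set j; k] \in G ->
  partial_tree G (j |: S) ([set j; k] |: F).
Proof.
case=> sFG sFS Fconn cardF jS kS Gjk.
have sFF' : F \subset [set j; k] |: F by apply: subsetUr.
split.
- by rewrite subUset sub1set Gjk.
- move=> e /setU1P[->|/sFS sS]; last exact: subset_trans sS (subsetUr _ _).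
  by apply/subsetP=> i /set2P[]->; rewrite ?setU11 // setU1r.
- have to_k i : i \in j |: S -> connect (adj ([set j; k] |: F)) i k.
    case/setU1P=> [->|iS]; first by apply: connect1; rewrite /adj setU11.
    by apply: connect_adjS sFF' _ _ _; apply: Fconn.
  move=> a b /to_k ak /to_k bk; apply: connect_trans ak _.
  by rewrite connect_adj_sym.
- rewrite !cardsU1 jS -cardF; suff -> : [set j; k] \notin F by [].
  by apply: contra jS => /sFS/subsetP; apply; rewrite set21.
Qed.

Lemma partial_tree_grow n (G : {set edge n}) S F :
    connected_graph G -> partial_tree G S F -> S != [set: 'I_n] ->
  exists j k, [/\ j \notin S, k \in S & [set j; k] \in G].
Proof.
move=> Gconn [_ _ _ cardF]; rewrite -subTset => /subsetPn[q _ qS].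
have /card_gt0P[v vS] : (0 < #|S|)%N by rewrite -cardF.
have [x [y [xS yS Gxy _ _]]] := crossing_edge (Gconn q v) qS vS.
by exists x, y.
Qed.

Lemma partial_tree_full n (G F : {set edge n}) :
  partial_tree G [set: 'I_n] F -> connected_graph F /\ #|F|.+1 = n.
Proof.
case=> _ _ Fconn; rewrite cardsT card_ord => cardF.
by split=> // i j; apply: Fconn; rewrite inE.
Qed.

(** Grow a tree from an arbitrary vertex, an edge at a time, until it reaches
    all the vertices. *)
Lemma connected_skeleton n (G : {set edge n}) : (0 < n)%N ->
    connected_graph G ->
  exists F : {set edge n}, [/\ F \subset G, connected_graph F & #|F|.+1 = n].
Proof.
move=> n_gt0 Gconn.
suff grow m : (m < n)%N -> exists S F, partial_tree G S F /\ #|S| = m.+1.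
  have [|S [F [treeF cardS]]] := grow n.-1; first by rewrite prednK.
  have ST : S = [set: 'I_n].
    by apply/eqP; rewrite eqEcard subsetT cardsT card_ord cardS prednK /=.
  rewrite ST in treeF; have [sFG _ _ _] := treeF.
  by have [Fconn cardF] := partial_tree_full treeF; exists F.
elim: m => [_|m IHm m_lt].
  by exists [set Ordinal n_gt0], finset.set0; split;
    [apply: partial_tree1 | rewrite cards1].
have [S [F [treeF cardS]]] := IHm (ltnW m_lt).
have [|j [k [jS kS Gjk]]] := partial_tree_grow Gconn treeF.
  by apply: contraTneq m_lt => ST; rewrite -cardS ST cardsT card_ord ltnn.
exists (j |: S), ([set j; k] |: F); split; first exact: partial_tree_add.
by rewrite cardsU1 jS cardS.
Qed.

(** An edge outside of a connected spanning subgraph with [n - 1] edges would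
    not be a bridge, so a tree equals any such subgraph. *)
Lemma spanning_tree_card n (G T : {set edge n}) : (0 < n)%N ->
  simple_edges G -> spanning_tree G T -> #|T|.+1 = n.
Proof.
move=> n_gt0 Gsimple [sTG Tconn Tacyc].
have [F [sFT Fconn cardF]] := connected_skeleton n_gt0 Tconn.
suff -> : T = F by [].
apply/eqP; rewrite eqEsubset sFT andbT; apply/subsetP=> e Te.
apply/negPn/negP=> Fe.
have /eqP/cards2P[a [b [neq_ab e_ab]]] := Gsimple e (subsetP sTG _ Te).
rewrite e_ab in Te Fe.
apply: (negP (acyclic_bridge Tacyc neq_ab Te)).
apply: connect_adjS (Fconn a b).
by rewrite subsetD1 sFT.
Qed.

(** Removing an edge of a cycle would leave a connected graph with fewer than
    [n - 1] edges, contradicting [connected_skeleton]. *)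
Lemma connected_card_acyclic n (T : {set edge n}) :
  connected_graph T -> (#|T| < n)%N -> acyclic T.
Proof.
move=> Tconn card_lt [|i [|a [|b p]]] // _ /andP[]; rewrite (cycle_path i).
rewrite [path _ _ _]/= => /and4P[T_last_i Tia Tab Tbp].
rewrite cons_uniq => /andP[i_ap /= /andP[a_bp _]].
have Te : [set i; a] \in T by [].
have conn_e : connected_graph (T :\ [set i; a]).
  apply: (connected_replace_edge Tconn (subxx _)).
  (* The rest of the cycle leads from a back to i. *)
  rewrite connect_adj_sym; apply/connectP; exists (rcons (b :: p) i).
    rewrite rcons_path path_avoid //=; last by rewrite Tab.
    rewrite /adj in_setD1; apply/andP; split=> //.
    apply: contraNneq a_bp => e_li.
    have: a \in [set last b p; i] by rewrite e_li set22.
    rewrite in_set2 => /orP[/eqP->|/eqP ai]; first exact: mem_last.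
    by rewrite ai mem_head in i_ap.
  by rewrite last_rcons.
have n_gt0 : (0 < n)%N by apply: leq_ltn_trans card_lt.
have [F [/subset_leq_card leFT _ cardF]] := connected_skeleton n_gt0 conn_e.
have : (#|T| < #|F|.+1)%N by rewrite cardF.
by rewrite (cardsD1 [set i; a]) Te ltnS ltnNge leFT.
Qed.

(** * The greedy algorithm *)

(** Twice the contribution of an edge to the squared norm of a tree. *)
Definition edge_cost (R : realType) n (w : edge n -> R) (eps : 'I_n -> R)
    (sw sv : R) (e : edge n) : R :=
  sv ^+ 2 * (\sum_(i in e) (eps i)^-1) + sw ^+ 2 * (w e)^-1.

Lemma greedy_costE (R : realType) n (w : edge n -> R) (eps : 'I_n -> R)
    (sw sv : R) (j k : 'I_n) : j != k ->
  greedy_cost w eps sw sv j k = edge_cost w eps sw sv [set j; k].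
Proof.
move=> neq_jk; rewrite /greedy_cost /edge_cost big_setU1 ?in_set1 //=.
by rewrite big_set1 [X in sv ^+ 2 * X]addrC.
Qed.

Lemma spanning_tree_exchange n (G T : {set edge n}) (S : {set 'I_n})
    (j k : 'I_n) :
    simple_edges G -> spanning_tree G T -> [set j; k] \in G ->
    j \notin S -> k \in S -> [set j; k] \notin T ->
  exists x y, [/\ x \notin S, y \in S, [set x; y] \in T &
    spanning_tree G ([set j; k] |: T :\ [set x; y])].
Proof.
move=> Gsimple treeT Gjk jS kS Tjk; have [sTG Tconn _] := treeT.
have [x [y [xS yS Txy jx yk]]] := crossing_edge (Tconn j k) jS kS.
exists x, y; split=> //; set F := _ |: _.
have sTF : T :\ [set x; y] \subset F by apply: subsetUr.
have Fconn : connected_graph F.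
  apply: (connected_replace_edge Tconn sTF).
  apply: (@connect_trans _ _ j).
    by rewrite connect_adj_sym; exact: connect_adjS sTF _ _ jx.
  apply: (@connect_trans _ _ k); first by apply: connect1; rewrite /adj setU11.
  by rewrite connect_adj_sym; exact: connect_adjS sTF _ _ yk.
split=> //.
  by rewrite subUset sub1set Gjk (subset_trans _ sTG) ?subD1set.
apply: connected_card_acyclic => //.
have n_gt0 : (0 < n)%N by apply: leq_ltn_trans (ltn_ord j).
have := spanning_tree_card n_gt0 Gsimple treeT.
by rewrite cardsU1 in_setD1 (negPf Tjk) andbF (cardsD1 [set x; y] T) Txy => ->.
Qed.

(** The safe edge property of Prim's algorithm, for any cost of the edges: the
    edge dropped in the exchange crosses the same cut as [jk], hence is not in
    [F], and costs at least as much as [jk]. *)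
Lemma greedy_edge_safe (R : realType) n (G : {set edge n}) (c : edge n -> R)
    S F (j k : 'I_n) (T : {set edge n}) :
    simple_edges G -> partial_tree G S F ->
    j \notin S -> k \in S -> [set j; k] \in G ->
    (forall x y, x \notin S -> y \in S -> [set x; y] \in G ->
       c [set j; k] <= c [set x; y]) ->
    spanning_tree G T -> F \subset T ->
  exists T' : {set edge n}, [/\ spanning_tree G T', [set j; k] |: F \subset T' &
    \sum_(e in T') c e <= \sum_(e in T) c e].
Proof.
move=> Gsimple [_ sFS _ _] jS kS Gjk jk_min treeT sFT.
have [Tjk|Tjk] := boolP ([set j; k] \in T).
  by exists T; rewrite subUset sub1set Tjk.
have [x [y [xS yS Txy treeT']]] :=
  spanning_tree_exchange Gsimple treeT Gjk jS kS Tjk.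
exists ([set j; k] |: T :\ [set x; y]); split=> //.
  apply: setUS; rewrite subsetD1 sFT; apply: contra xS => /sFS/subsetP.
  by apply; rewrite set21.
rewrite big_setU1 ?in_setD1 ?(negPf Tjk) ?andbF //= (big_setD1 _ Txy) /=.
by rewrite lerD2r jk_min //; case: treeT => /subsetP/(_ _ Txy).
Qed.

(** Separates the combinatorial optimality from its reading in terms of
    norms. *)
Lemma greedy_ensures_impl (R : realType) n (G : {set edge n})
    (w : edge n -> R) (eps : 'I_n -> R) (sw sv : R)
    (post post' : greedy_state n -> Prop) (s : greedy_state n) :
    (forall s', post s' -> post' s') ->
  greedy_ensures G w eps sw sv post s -> greedy_ensures G w eps sw sv post' s.
Proof.
move=> postW; elim=> {}s.
  by move=> rem0 post_s; apply: greedy_stop => //; apply: postW.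
by move=> rem_gt0 step _ IHs; apply: greedy_iter.
Qed.

(** Having a tree above the chosen edges and no more expensive than [T'], for
    every [T'] at once, replaces the usual invariant that the chosen edges
    extend to an optimal tree; it holds at the start without knowing that an
    optimal tree exists. *)
Lemma greedy_correct (R : realType) n (G : {set edge n}) (w : edge n -> R)
    (eps : 'I_n -> R) (sw sv : R) (s : greedy_state n) :
    simple_edges G -> connected_graph G ->
    remaining s = ~: reached s -> partial_tree G (reached s) (chosen s) ->
    (forall T', spanning_tree G T' -> exists T : {set edge n},
       [/\ spanning_tree G T, chosen s \subset T &
         \sum_(e in T) edge_cost w eps sw sv e
           <= \sum_(e in T') edge_cost w eps sw sv e]) ->
  greedy_ensures G w eps sw sv
    (fun s => [/\ reached s = [set: 'I_n], spanning_tree G (chosen s)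
       & forall T', spanning_tree G T' ->
           \sum_(e in chosen s) edge_cost w eps sw sv e
             <= \sum_(e in T') edge_cost w eps sw sv e]) s.
Proof.
move=> Gsimple Gconn; move: {2}#|_| (erefl #|remaining s|) => r.
elim: r s => [|r IHr] s card_rem remE treeS extS.
  have reachE : reached s = [set: 'I_n].
    by rewrite -[LHS]finset.setCK -remE (cards0_eq card_rem) finset.setC0.
  apply: greedy_stop => //; split=> //.
    rewrite reachE in treeS; have [sFG _ _ _] := treeS.
    have [Fconn cardF] := partial_tree_full treeS.
    by split=> //; apply: connected_card_acyclic => //; rewrite cardF.
  move=> T' treeT'; have [T [treeT sFT leT]] := extS T' treeT'.
  suff -> : chosen s = T by [].
  rewrite reachE in treeS; have [_ cardF] := partial_tree_full treeS.
  have n_gt0 : (0 < n)%N by rewrite -cardF.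
  apply/eqP; rewrite eqEcard sFT -ltnS cardF.
  exact/eq_leq/(spanning_tree_card n_gt0 Gsimple treeT).
have candE j k : candidate G s j k =
    [&& j \notin reached s, k \in reached s & [set j; k] \in G].
  apply/and3P/and3P=> -[jS kS Gjk]; split=> //; move: jS.
    by rewrite inE remE in_setC => /andP[].
  rewrite inE remE in_setC => -> /=.
  by apply/existsP; exists k; rewrite kS finset.setUC.
have notfull : reached s != [set: 'I_n].
  apply/eqP=> reachE.
  by move: card_rem; rewrite remE reachE finset.setCT cards0.
apply: greedy_iter; first by rewrite card_rem.
- have [j0 [k0 [j0S k0S G0]]] := partial_tree_grow Gconn treeS notfull.
  pose cost (p : 'I_n * 'I_n) := greedy_cost w eps sw sv p.1 p.2.
  pose cand (p : 'I_n * 'I_n) := candidate G s p.1 p.2.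
  have cand0 : cand (j0, k0) by rewrite /cand candE j0S k0S.
  case: (Order.TotalTheory.arg_minP cost cand0) => -[j k] cand_jk min_jk.
  eexists; exists j, k; split=> // j' k' cand'.
  exact: (min_jk (j', k')).
- move=> s' [j [k [cand_jk min_jk ->]]].
  have /and3P[jS kS Gjk] : [&& j \notin reached s, k \in reached s
    & [set j; k] \in G] by rewrite -candE.
  have neqS x y : x \notin reached s -> y \in reached s -> x != y.
    by move=> xS yS; apply: contraNneq xS => ->.
  apply: IHr => /=.
  + have := cardsD1 j (remaining s); rewrite card_rem.
    by rewrite {1}remE in_setC jS => -[].
  + by rewrite remE finset.setDE -finset.setCU finset.setUC.
  + exact: partial_tree_add.
  + move=> T' treeT'; have [T [treeT sFT leT]] := extS T' treeT'.
    have [|T1 [treeT1 sFT1 leT1]] := greedy_edge_safe (c := edge_cost w eps sw sv)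
      Gsimple treeS jS kS Gjk _ treeT sFT.
      move=> x y xS yS Gxy; rewrite -!greedy_costE ?neqS //.
      by apply: min_jk; rewrite candE xS yS.
    by exists T1; split=> //; apply: le_trans leT.
Qed.

(** * Stability and the Lyapunov equation of weighted gradient systems *)

Lemma weighted_norm2_gt0 (C : numDomainType) m (a v : 'rV[C]_m) :
  (forall i, 0 < a 0 i) -> v != 0 -> 0 < \sum_i a 0 i * `|v 0 i| ^+ 2.
Proof.
move=> a_gt0 /rV0Pn[i v_i]; rewrite (bigD1 i) //= ltr_pwDl //.
  by rewrite mulr_gt0 // exprn_gt0 // normr_gt0.
by apply: sumr_ge0 => k _; rewrite mulr_ge0 ?exprn_ge0 // ltW.
Qed.

(** With [u = v D^T] for a left eigenvector [v], evaluating
    [\sum_i a_i |u_i|^2] through the eigenvalue equation gives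
    [- z * \sum_k |v_k|^2 / b_k]; both sums are positive, as [D] is
    injective. *)
Lemma eigenvalue_gradient_lt0 (C : numClosedFieldType) n m
    (D : 'M[C]_(n, m)) (Y : 'M[C]_(m, n)) (a : 'rV[C]_n) (b : 'rV[C]_m) z :
    (forall i k, D i k \is Num.real) -> Y *m D = 1%:M ->
    (forall i, 0 < a 0 i) -> (forall k, 0 < b 0 k) ->
  eigenvalue (- (D^T *m diag_mx a *m D *m diag_mx b)) z -> z < 0.
Proof.
move=> D_real YD a_gt0 b_gt0 /eigenvalueP[v vA v_neq0].
pose u := v *m D^T.
have u_neq0 : u != 0.
  apply: contraNneq v_neq0 => u0; apply/eqP.
  by rewrite -[v]mulmx1 -(trmx1 C m) -YD trmx_mul mulmxA -/u u0 mul0mx.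
pose p := \sum_i a 0 i * `|u 0 i| ^+ 2.
pose q := \sum_k (\row_k (b 0 k)^-1) 0 k * `|v 0 k| ^+ 2.
have p_gt0 : 0 < p by apply: weighted_norm2_gt0.
have q_gt0 : 0 < q.
  by apply: weighted_norm2_gt0 => // k; rewrite mxE invr_gt0.
have conj_u i : (u 0 i)^* = \sum_k (v 0 k)^* * D i k.
  rewrite mxE rmorph_sum; apply: eq_bigr => k _.
  by rewrite !mxE rmorphM /= (conj_Creal (D_real _ _)).
have vAk k : \sum_i u 0 i * a 0 i * D i k = - z * ((b 0 k)^-1 * v 0 k).
  have := congr1 (fun M : 'rV_m => M 0 k) vA.
  rewrite mulmxN !mulmxA -/u mxE mul_mx_diag [X in - X = _]mxE => /eqP.
  rewrite mxE eqr_oppLR [in X in _ == X]mxE -mulNr => /eqP eq_k.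
  rewrite mulrCA -eq_k mulrC mulfK ?gt_eqF //.
  by apply: eq_bigr => i _; rewrite mul_mx_diag mxE.
have p_eq : p = - z * q.
  rewrite /p /q mulr_sumr.
  have expand k : - z * ((\row_k (b 0 k)^-1) 0 k * `|v 0 k| ^+ 2)
      = \sum_i u 0 i * a 0 i * D i k * (v 0 k)^*.
    by rewrite mxE normCK !mulrA -[_ * _ * v 0 k]mulrA -vAk mulr_suml.
  under [RHS]eq_bigr do rewrite expand.
  rewrite exchange_big; apply: eq_bigr => i _ /=.
  rewrite normCK conj_u mulrA [a 0 i * _]mulrC mulr_sumr.
  by apply: eq_bigr => k _; rewrite mulrA mulrAC.
by rewrite -oppr_gt0 -(pmulr_lgt0 _ q_gt0) -p_eq.
Qed.

Lemma hurwitz_gradient (R : realType) n m (D : 'M[R]_(n, m)) (Y : 'M[R]_(m, n))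
    (a : 'rV[R]_n) (b : 'rV[R]_m) :
    Y *m D = 1%:M -> (forall i, 0 < a 0 i) -> (forall k, 0 < b 0 k) ->
  hurwitz (- (D^T *m diag_mx a *m D *m diag_mx b)).
Proof.
move=> YD a_gt0 b_gt0 z.
rewrite map_mxN !map_mxM !map_diag_mx -map_trmx => eig_z.
suff : z < 0 by rewrite ltcE => /andP[].
apply: (eigenvalue_gradient_lt0 (Y := map_mx (real_complex R) Y)) eig_z.
- move=> i k; rewrite mxE realE.
  by rewrite -[0]/(real_complex R 0) !lecR -realE num_real.
- by rewrite -map_mxM YD map_mx1.
- by move=> i; rewrite mxE -[0]/(real_complex R 0) ltcR.
- by move=> i; rewrite mxE -[0]/(real_complex R 0) ltcR.
Qed.

(** The product of the positive semidefinite matrices [B^T diag(a) B] and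
    [diag(b)] need not be symmetric, but its trace is a weighted sum of squares,
    which is what makes it usable as a norm of [B]. *)
Lemma trace_gram (R : realFieldType) p q (B : 'M[R]_(p, q))
    (a : 'rV[R]_p) (b : 'rV[R]_q) :
  \tr (B^T *m diag_mx a *m B *m diag_mx b) =
  \sum_k \sum_i a 0 i * b 0 k * B i k ^+ 2.
Proof.
apply: eq_bigr => k _; rewrite mul_mx_diag mxE -mulmxA mul_diag_mx mxE.
by rewrite mulr_suml; apply: eq_bigr => i _; rewrite !mxE; ring.
Qed.

Lemma trace_gram_ge0 (R : realFieldType) p q (B : 'M[R]_(p, q))
    (a : 'rV[R]_p) (b : 'rV[R]_q) :
  (forall i, 0 < a 0 i) -> (forall k, 0 < b 0 k) ->
  0 <= \tr (B^T *m diag_mx a *m B *m diag_mx b).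
Proof.
move=> a_gt0 b_gt0; rewrite trace_gram; apply: sumr_ge0 => k _.
by apply: sumr_ge0 => i _; rewrite mulr_ge0 ?sqr_ge0 // ltW ?mulr_gt0.
Qed.

Lemma trace_gram_eq0 (R : realFieldType) p q (B : 'M[R]_(p, q))
    (a : 'rV[R]_p) (b : 'rV[R]_q) :
  (forall i, 0 < a 0 i) -> (forall k, 0 < b 0 k) ->
  \tr (B^T *m diag_mx a *m B *m diag_mx b) <= 0 -> B = 0.
Proof.
move=> a_gt0 b_gt0 tr_le0; apply/matrixP=> i k; rewrite mxE.
have ab_gt0 i' k' : 0 < a 0 i' * b 0 k' by rewrite mulr_gt0.
have: \tr (B^T *m diag_mx a *m B *m diag_mx b) == 0.
  by rewrite eq_le tr_le0 trace_gram_ge0.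
rewrite trace_gram psumr_eq0 => [/allP/(_ k (mem_index_enum _))/=|k' _]; last first.
  by apply: sumr_ge0 => i' _; rewrite mulr_ge0 ?sqr_ge0 // ltW.
rewrite psumr_eq0 => [/allP/(_ i (mem_index_enum _))/=|i' _]; last first.
  by rewrite mulr_ge0 ?sqr_ge0 // ltW.
by rewrite mulf_eq0 gt_eqF //= sqrf_eq0 => /eqP.
Qed.

Lemma diag_mxK (R : fieldType) m (b : 'rV[R]_m) : (forall k, b 0 k != 0) ->
  diag_mx (\row_k (b 0 k)^-1) *m diag_mx b = 1%:M.
Proof.
move=> b_neq0; rewrite mulmx_diag -diag_const_mx; congr diag_mx.
by apply/rowP=> k; rewrite !mxE mulVf.
Qed.

(** Uniqueness for the Lyapunov equation.  In the coordinates where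
    [W^(1/2) L W^(1/2) = S] is symmetric, [Z = W^(1/2) X W^(1/2)] satisfies
    [S Z + Z S = 0], hence [tr (Z^T S Z) + tr (Z S Z^T) = 0]; multiplying by
    [W X^T W] expresses the same computation without square roots. *)
Lemma lyapunov_gradient_eq0 (R : realType) n m (D : 'M[R]_(n, m))
    (Y : 'M[R]_(m, n)) (a : 'rV[R]_n) (b : 'rV[R]_m) (X : 'M[R]_m) :
    Y *m D = 1%:M -> (forall i, 0 < a 0 i) -> (forall k, 0 < b 0 k) ->
    let M := D^T *m diag_mx a *m D *m diag_mx b in
  M *m X + X *m M^T = 0 -> X = 0.
Proof.
move=> YD a_gt0 b_gt0 M MX0.
pose W := diag_mx b; pose L := D^T *m diag_mx a *m D.
have WT : W^T = W by rewrite tr_diag_mx.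
have LT : L^T = L by rewrite !trmx_mul trmxK tr_diag_mx mulmxA.
have MT : M^T = W *m L by rewrite trmx_mul LT WT.
have tr0 : \tr (W *m X^T *m W *m (L *m W *m X)) +
    \tr (W *m X^T *m W *m (X *m W *m L)) = 0.
  by rewrite -linearD -mulmxDr -[X *m W *m L]mulmxA -MT MX0 mulmx0 linear0.
have tr1 : \tr (W *m X^T *m W *m (L *m W *m X)) =
    \tr ((D *m W *m X)^T *m diag_mx a *m (D *m W *m X) *m diag_mx b).
  by rewrite !trmx_mul WT -/W [in RHS]mxtrace_mulC /L !mulmxA.
have tr2 : \tr (W *m X^T *m W *m (X *m W *m L)) =
    \tr ((X *m W *m D^T)^T *m diag_mx b *m (X *m W *m D^T) *m diag_mx a).
  rewrite !trmx_mul trmxK WT -/W [in LHS]/L !mulmxA.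
  by rewrite [LHS]mxtrace_mulC !mulmxA.
have DWX0 : D *m W *m X = 0.
  apply: (trace_gram_eq0 a_gt0 b_gt0); rewrite -tr1 -[leRHS]tr0 lerDl tr2.
  exact: trace_gram_ge0.
have /(congr1 (mulmx Y)) : D *m (W *m X) = 0 by rewrite mulmxA.
rewrite mulmxA YD mul1mx mulmx0.
move/(congr1 (mulmx (diag_mx (\row_k (b 0 k)^-1)))).
by rewrite mulmxA diag_mxK ?mul1mx ?mulmx0 // => k; rewrite gt_eqF.
Qed.

(** For this noise intensity the ansatz [x W^-1 + y L] solves the Lyapunov
    equation, because [L W] turns [W^-1] into [L] and [L] into [L W L]. *)
Lemma H2_squared_gradient (R : realType) n m (D : 'M[R]_(n, m))
    (Y : 'M[R]_(m, n)) (a : 'rV[R]_n) (b : 'rV[R]_m) (s t : R) :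
    Y *m D = 1%:M -> (forall i, 0 < a 0 i) -> (forall k, 0 < b 0 k) ->
    let L := D^T *m diag_mx a *m D in
    let W := diag_mx b in
  H2_squared (- (L *m W)) (s *: L + t *: (L *m W *m L)) 1%:M
    = (s / 2 * (\sum_k (b 0 k)^-1) + t / 2 * \tr L)%:E.
Proof.
move=> YD a_gt0 b_gt0 L W.
have b_neq0 k : b 0 k != 0 by rewrite gt_eqF.
have LT : L^T = L by rewrite !trmx_mul trmxK tr_diag_mx mulmxA.
have MT : (- (L *m W))^T = - (W *m L).
  by rewrite linearN /= trmx_mul LT tr_diag_mx.
pose W' := diag_mx (\row_k (b 0 k)^-1).
have W'W : W' *m W = 1%:M by apply: diag_mxK.
have WW' : W *m W' = 1%:M by apply: mulmx1C.
pose X := (s / 2) *: W' + (t / 2) *: L.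
have halves (x : R) (M : 'M[R]_m) : (x / 2) *: M + (x / 2) *: M = x *: M.
  by rewrite -scalerDl -splitr.
have X_sol : - (L *m W) *m X + X *m (- (L *m W))^T
    + (s *: L + t *: (L *m W *m L)) = 0.
  rewrite MT mulNmx mulmxN -opprD mulmxDr mulmxDl -!scalemxAr -!scalemxAl.
  rewrite -[L *m W *m W']mulmxA WW' mulmx1 [W' *m _]mulmxA W'W mul1mx.
  by rewrite [L *m (W *m L)]mulmxA addrACA !halves addNr.
rewrite /H2_squared asboolT; last exact: hurwitz_gradient YD a_gt0 b_gt0.
rewrite trmx1 mul1mx mulmx1; congr (_%:E).
suff -> : lyapunov_sol (- (L *m W)) (s *: L + t *: (L *m W *m L)) = X.
  rewrite linearD !linearZ /= mxtrace_diag; congr (_ * _ + _).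
  by apply: eq_bigr => k _; rewrite mxE.
apply: xget_unique => //= X' X'_sol.
apply/eqP; rewrite -subr_eq0; apply/eqP.
apply: (lyapunov_gradient_eq0 YD a_gt0 b_gt0).
apply: oppr_inj; rewrite oppr0 opprD -mulNmx -[X in _ + X]mulmxN.
have -> : - (D^T *m diag_mx a *m D *m diag_mx b)^T = (- (L *m W))^T.
  by rewrite linearN.
have /eqP := etrans X'_sol (esym X_sol).
rewrite (inj_eq (addIr _)) -subr_eq0 => /eqP <-.
by rewrite mulmxBr mulmxBl opprD addrACA.
Qed.

(** * Incidence matrices of forests *)

(** A row vector [y] is a potential on the vertices, and [y D] records its
    differences along the edges. *)
Lemma mul_incidence (R : realType) n (o : edge n -> 'I_n) (F : {set edge n})
    (y : 'rV[R]_n) (k : 'I_#|F|) (c d : 'I_n) :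
    enum_val k = [set c; d] -> c != d -> o [set c; d] \in [set c; d] ->
  (y *m incidence R o F) 0 k
    = (-1) ^+ (o [set c; d] != c) * (y 0 c - y 0 d).
Proof.
move=> e_k neq_cd /set2P o_cd.
rewrite mxE (bigD1 c) //= (bigD1 d) 1?eq_sym //= big1 => [|i /andP[ic id]].
  rewrite !mxE /= e_k !in_set2 !eqxx orbT /= addr0.
  by case: o_cd => ->;
    rewrite eqxx ?(negPf neq_cd) 1?eq_sym ?(negPf neq_cd) /=; ring.
rewrite mxE /= e_k in_set2 (negPf ic) (negPf id).
by case: o_cd => ->; rewrite ?(negPf ic) ?(negPf id) mulr0.
Qed.

(** Removing an edge [ab] of a forest separates [a] from [b].  The indicator of
    the component of [a] is constant along every other edge, so multiplying it
    by [D] leaves only the entry of [ab]. *)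
Lemma incidence_left_inverse (R : realType) n (o : edge n -> 'I_n)
    (T : {set edge n}) :
    simple_edges T -> acyclic T -> orientation T o ->
  exists Y : 'M[R]_(#|T|, n), Y *m incidence R o T = 1%:M.
Proof.
move=> Tsimple Tacyc To.
have cut k : exists y : 'rV[R]_n, y *m incidence R o T = delta_mx 0 k.
  have Te := enum_valP k.
  have /eqP/cards2P[a [b [neq_ab e_ab]]] := Tsimple _ Te.
  have bridge : ~~ connect (adj (T :\ [set a; b])) a b.
    by apply: acyclic_bridge; rewrite // -e_ab.
  pose y : 'rV[R]_n := \row_i (connect (adj (T :\ [set a; b])) a i)%:R.
  exists ((-1) ^+ (o [set a; b] != a) *: y).
  apply/rowP=> k'; rewrite -scalemxAl [in LHS]mxE [in RHS]mxE eqxx /=.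
  have Te' := enum_valP k'.
  have /eqP/cards2P[c [d [neq_cd e_cd]]] := Tsimple _ Te'.
  have o_e e : e \in T -> o e \in e by apply: To.
  have [->|neq_k] := eqVneq k' k.
    rewrite (mul_incidence _ e_ab) // -?e_ab ?o_e // !mxE.
    by rewrite connect0 (negPf bridge) subr0 mulr1 -expr2 sqrr_sign.
  rewrite (mul_incidence _ e_cd) // -?e_cd ?o_e // !mxE.
  suff -> : connect (adj (T :\ [set a; b])) a c
      = connect (adj (T :\ [set a; b])) a d by rewrite subrr !mulr0.
  apply: (same_connect_r (connect_adj_sym _)); apply: connect1.
  by rewrite /adj in_setD1 -e_cd Te' andbT -e_ab (inj_eq enum_val_inj).
have [y yD] := fin_all_exists cut.
exists (\matrix_k y k); apply/row_matrixP=> k.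
by rewrite row_mul rowK yD row1.
Qed.

Lemma trace_edge_laplacian (R : realType) n (o : edge n -> 'I_n)
    (T : {set edge n}) (a : 'rV[R]_n) : orientation T o ->
  \tr ((incidence R o T)^T *m diag_mx a *m incidence R o T)
    = \sum_(e in T) \sum_(i in e) a 0 i.
Proof.
move=> To; rewrite [RHS]big_enum_val; apply: eq_bigr => k _.
have Te := enum_valP k; rewrite [RHS]big_mkcond mxE; apply: eq_bigr => i _.
rewrite mul_mx_diag !mxE /=.
have [->|_] := eqVneq i (o _); first by rewrite (To _ Te) mulr1 mul1r.
by case: ifP => _; ring.
Qed.

(** Both sides count the incident pairs of a vertex and an edge. *)
Lemma sum_degree (R : realType) n (T : {set edge n}) (a : 'I_n -> R) :
  \sum_(i < n) (deg T i)%:R * a i = \sum_(e in T) \sum_(i in e) a i.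
Proof.
under [RHS]eq_bigr do rewrite big_mkcond.
rewrite exchange_big; apply: eq_bigr => i _ /=.
rewrite -big_mkcondr /= mulr_natl -sumr_const.
by apply: eq_bigl => e; rewrite inE.
Qed.

Lemma invmx_vdiag (R : realType) n (eps : 'I_n -> R) :
  (forall i, 0 < eps i) -> invmx (vdiag eps) = vdiag (fun i => (eps i)^-1).
Proof.
move=> eps_gt0.
have inv1 : vdiag (fun i => (eps i)^-1) *m vdiag eps = 1%:M.
  rewrite mulmx_diag -diag_const_mx; congr diag_mx.
  by apply/rowP=> i; rewrite !mxE mulVf // gt_eqF.
have [_ unit_eps] := mulmx1_unit inv1.
by rewrite -[RHS]mulmx1 -(mulmxV unit_eps) mulmxA inv1 mul1mx.
Qed.

(** The block of [R_T] for the edges outside of the tree has no column, but its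
    width [#|T :\: T|] is only provably zero: the block is removed by showing
    that its contribution is an empty sum. *)
Lemma Rmx_tree (R : realType) n (o : edge n -> 'I_n) (T : {set edge n})
    (f : edge n -> R) :
  Rmx R o T T *m ediag T T f *m (Rmx R o T T)^T
    = diag_mx (\row_k f (enum_val k)).
Proof.
rewrite /Rmx /ediag diag_mx_row mul_row_block tr_row_mx mul_row_col.
rewrite trmx1 mul1mx !mulmx0 addr0 add0r mulmx1 -[RHS]addr0; congr (_ + _).
apply/matrixP=> i j; rewrite [LHS]mxE [RHS]mxE big1 // => k _.
by have := enum_valP k; rewrite in_setD andNb.
Qed.

(** * The squared norm of a tree *)

(** On a forest the system is a weighted gradient system, to which
    [H2_squared_gradient] applies. *)
Lemma H2_edge_consensus_forest (R : realType) n (w : edge n -> R)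
    (eps : 'I_n -> R) (sw sv : R) (o : edge n -> 'I_n) (T : {set edge n}) :
    simple_edges T -> acyclic T -> orientation T o ->
    (forall e, e \in T -> 0 < w e) -> (forall i, 0 < eps i) ->
  H2_edge_consensus w eps sw sv o T T =
    (sw ^+ 2 / 2 * (\sum_(e in T) (w e)^-1)
     + sv ^+ 2 / 2 * (\sum_(i < n) (deg T i)%:R / eps i))%:E.
Proof.
move=> Tsimple Tacyc To w_gt0 eps_gt0.
have [Y YD] := incidence_left_inverse R Tsimple Tacyc To.
set D := incidence R o T in YD.
pose a := \row_i (eps i)^-1; pose b := \row_(k < #|T|) w (enum_val k).
have a_gt0 i : 0 < a 0 i by rewrite mxE invr_gt0.
have b_gt0 k : 0 < b 0 k by rewrite mxE w_gt0 ?enum_valP.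
pose L := D^T *m diag_mx a *m D; pose W := diag_mx b.
have LE : edge_laplacian eps o T = L by rewrite /edge_laplacian invmx_vdiag.
have LT : L^T = L by rewrite !trmx_mul trmxK tr_diag_mx mulmxA.
have RWR : Rmx R o T T *m ediag T T w *m (Rmx R o T T)^T = W by apply: Rmx_tree.
rewrite /H2_edge_consensus LE -/D invmx_vdiag //.
have -> : L *m Rmx R o T T *m ediag T T w *m (Rmx R o T T)^T = L *m W.
  by rewrite -RWR !mulmxA.
rewrite -!scalemxAl -!scalemxAr !scalerA -!expr2.
have -> : vdiag (fun i => Num.sqrt (eps i)) *m vdiag (fun i => Num.sqrt (eps i))
    = vdiag eps.
  rewrite mulmx_diag; congr diag_mx; apply/rowP=> i.
  by rewrite !mxE -expr2 sqr_sqrtr ?ltW.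
have -> : ediag T T (fun e => Num.sqrt (w e)) *m
    ediag T T (fun e => Num.sqrt (w e)) = ediag T T w.
  rewrite mulmx_diag; congr diag_mx; apply/rowP=> k; rewrite mxE.
  rewrite -(splitK k); case: (split k) => k' /=.
    by rewrite !row_mxEl !mxE -expr2 sqr_sqrtr // ltW // w_gt0 // enum_valP.
  rewrite !row_mxEr !mxE -expr2 sqr_sqrtr // ltW // w_gt0 //.
  by have := enum_valP k'; rewrite in_setD => /andP[].
rewrite -!scalemxAl.
have -> : D^T *m vdiag (fun i => (eps i)^-1) *m vdiag eps *m
    (D^T *m vdiag (fun i => (eps i)^-1))^T = L.
  rewrite trmx_mul trmxK tr_diag_mx mulmxA; congr (_ *m _).
  rewrite -!mulmxA; congr (_ *m _); rewrite !mulmx_diag.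
  congr diag_mx; apply/rowP=> i; rewrite !mxE.
  by rewrite mulfV ?mulr1 ?gt_eqF.
have -> : - (L *m Rmx R o T T) *m ediag T T w *m (- (L *m Rmx R o T T))^T
    = L *m W *m L.
  by rewrite linearN /= trmx_mul LT mulNmx mulmxN mulNmx opprK -RWR !mulmxA.
rewrite (H2_squared_gradient _ _ YD a_gt0 b_gt0) trace_edge_laplacian //.
rewrite sum_degree [in RHS]big_enum_val.
congr (_ * _ + _ * _)%:E; first by apply: eq_bigr => k _; rewrite mxE.
by apply: eq_bigr => e _; apply: eq_bigr => i _; rewrite mxE.
Qed.

Theorem proposition1 (R : realType) (n : nat) (G : {set edge n})
    (w : edge n -> R) (eps : 'I_n -> R) (sw sv : R) (o : edge n -> 'I_n)
    (G_simple : simple_edges G)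
    (G_connected : connected_graph G)
    (w_gt0 : forall e, e \in G -> 0 < w e)
    (eps_gt0 : forall i, 0 < eps i)
    (sw_gt0 : 0 < sw) (sv_gt0 : 0 < sv)
    (o_orientation : orientation G o) :
  (forall T', spanning_tree G T' ->
     H2_edge_consensus w eps sw sv o T' T' =
       (sw ^+ 2 / 2 * (\sum_(e in T') (w e)^-1)
        + sv ^+ 2 / 2 * (\sum_(i < n) (deg T' i)%:R / eps i))%:E)
  /\
  (forall v : 'I_n,
     greedy_ensures G w eps sw sv
       (fun s => [/\ reached s = [set: 'I_n],
          spanning_tree G (chosen s)
        & forall T', spanning_tree G T' ->
            (H2_edge_consensus w eps sw sv o (chosen s) (chosen s)
             <= H2_edge_consensus w eps sw sv o T' T')%E])
       (greedy_init v)).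
Proof.
have H2_tree T' : spanning_tree G T' -> H2_edge_consensus w eps sw sv o T' T' =
    (sw ^+ 2 / 2 * (\sum_(e in T') (w e)^-1)
     + sv ^+ 2 / 2 * (\sum_(i < n) (deg T' i)%:R / eps i))%:E.
  case=> /subsetP sT'G _ T'acyc; apply: H2_edge_consensus_forest => // e /sT'G.
  - exact: G_simple.
  - exact: o_orientation.
  - exact: w_gt0.
split=> // v.
have H2_cost T' : spanning_tree G T' -> H2_edge_consensus w eps sw sv o T' T' =
    (2^-1 * \sum_(e in T') edge_cost w eps sw sv e)%:E.
  move=> treeT'; rewrite (H2_tree _ treeT') sum_degree; congr (_%:E).
  by rewrite big_split /= -!mulr_sumr; ring.
apply: (greedy_ensures_impl _ (greedy_correct (s := greedy_init v) _ _ _ _ _)) => //.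
- move=> s [reachE tree_s s_min]; split=> // T' treeT'.
  by rewrite !H2_cost // lee_fin ler_pM2l ?invr_gt0 // s_min.
- by rewrite /= finset.setTD.
- exact: partial_tree1.
- by move=> T' treeT'; exists T'; rewrite finset.sub0set.
Qed.
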